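(* There is an absolute constant $C>0$ such that for every odd integer $t\ge 5$ and all positive integers $n\le m$ (with $m$ sufficiently large) there is a non-adaptive $(m,n,s,t)$-scheme with \[ s\le C\, t\, m^{\frac{2}{t-1}} n^{1-\frac{2}{t-1}}\lg\frac{2m}{n}. \]
   Context: $\lg$ denotes logarithm to base $2$. Let $[m]=\{1,\dots,m\}$. An $(m,n,s)$-storing scheme is a map $\phi$ from the family of subsets of $[m]$ of size at most $n$ to $\{0,1\}^s$. An $(m,s,t)$-query scheme is a family $\{T_u\}_{u\in[m]}$ of Boolean decision trees of depth at most $t$ whose internal nodes are marked with addresses in $\{1,\dots,s\}$ and whose leaves are marked Yes/No; $T_u$ maps $\{0,1\}^s$ to $\{\mathrm{Yes},\mathrm{No}\}$. An $(m,n,s,t)$-scheme is a pair $(\phi,\{T_u\})$ such that for every $S\subseteq[m]$ with $|S|\le n$ and every $u\in[m]$, $T_u(\phi(S))=\mathrm{Yes}$ iff $u\in S$. The scheme is non-adaptive if for each $u$ the set of (at most $t$) locations probed by $T_u$ is fixed, i.e. does not depend on the values read. *)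

(* Defs.v *)
From HB Require Import structures.
From mathcomp Require Import all_boot all_order all_algebra.
From mathcomp Require Import reals exp.

Set Implicit Arguments.
Unset Strict Implicit.
Unset Printing Implicit Defensive.

Import Order.TTheory GRing.Theory Num.Theory.

(* Memory {0,1}^s is s.-tuple bool, the address set {1, ..., s} is 'I_s, and
   the universe [m] is 'I_m. The leaf [Leaf true] is Yes, [Leaf false] is No;
   in [Node i l r] the computation continues in r when bit i is 1, in l when
   it is 0. *)
Inductive dtree (s : nat) : Type :=
| Leaf of bool
| Node of 'I_s & dtree s & dtree s.

Arguments Leaf {s}.

Fixpoint depth (s : nat) (T : dtree s) : nat :=
  if T is Node _ l r then (maxn (depth l) (depth r)).+1 else 0.

Fixpoint eval (s : nat) (T : dtree s) (x : s.-tuple bool) : bool :=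
  match T with
  | Leaf b => b
  | Node i l r => if tnth x i then eval r x else eval l x
  end.

Fixpoint probed (s : nat) (T : dtree s) (x : s.-tuple bool) : {set 'I_s} :=
  match T with
  | Leaf _ => set0
  | Node i l r => i |: (if tnth x i then probed r x else probed l x)
  end.

Definition storing_scheme (m n s : nat) : Type :=
  {S : {set 'I_m} | #|S| <= n} -> s.-tuple bool.

Definition query_scheme (m s t : nat) : Type :=
  'I_m -> {T : dtree s | depth T <= t}.

Record scheme (m n s t : nat) : Type := Scheme {
  store : storing_scheme m n s;
  query : query_scheme m s t;
  schemeP : forall (S : {S : {set 'I_m} | #|S| <= n}) (u : 'I_m),
    eval (sval (query u)) (store S) = true <-> u \in sval S
}.

(* The memory contents x are arbitrary, not only those produced by [store]. *)
Definition nonadaptive (m n s t : nat) (P : scheme m n s t) : Prop :=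
  forall u : 'I_m, exists L : {set 'I_s},
    #|L| <= t /\ forall x : s.-tuple bool, probed (sval (query P u)) x = L.

Local Open Scope ring_scope.

Definition lg (R : realType) (x : R) : R := ln x / ln 2.

(* Main.v *)
(* Give each u a set G u of t = 2 d - 1 addresses and answer by majority. A
   random G with s^(d-1) >= (256 d^2)^(d-1) m n^(d-2) expands: every X of size
   at most 2 d n has at least d #|X| neighbours. For #|S| <= n, expansion leaves
   at most (d - 1) #|S| elements u outside S with d or more addresses in G S, and
   Hall's theorem gives private majorities to these and to S. This costs one
   factor d too many in s: s is of order d^2 n (m/n)^(1/(d-1)). If d is at most
   of order lg(2m/n), the logarithm of the claimed bound pays for it; otherwise
   only about 2 lg(2m/n) of the t probes are used, for which (m/n)^(1/(d-1)) is
   bounded. *)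
Require Import Defs.
From HB Require Import structures.
From mathcomp Require Import all_boot all_order all_algebra.
From mathcomp Require Import reals exp.
From mathcomp Require Import zify ring lra.

Set Implicit Arguments.
Unset Strict Implicit.
Unset Printing Implicit Defensive.

Import Order.TTheory GRing.Theory Num.Theory.

(** * Hall's marriage theorem *)

(* Induction on the total size of the r x: if r x contains y1 != y2, then y1 or
   y2 can be removed from r x, since violators X1 and X2 of Hall's condition for
   the two removals would give, by submodularity of X |-> #|r X|, a violator
   X1 :|: X2 or (X1 :&: X2) :\ x for r. *)
Lemma hall (A B : finType) (b0 : B) (D : {set A}) (r : A -> {set B}) :
  (forall X : {set A}, X \subset D -> #|X| <= #|\bigcup_(x in X) r x|) ->
  exists f : A -> B, {in D &, injective f} /\ {in D, forall x, f x \in r x}.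
Proof.
have [N] := ubnP (\sum_(x in D) #|r x|).
elim: N r => // N IHN r /ltnSE ltN hallr.
have [/forall_inP small|] := boolP [forall x in D, #|r x| <= 1].
  pose f x := odflt b0 [pick y in r x].
  have fP x : x \in D -> f x \in r x.
    move=> xD; rewrite /f; case: pickP => //= r0.
    have := hallr [set x]; rewrite sub1set xD cards1 big_set1 => /(_ isT).
    by rewrite eq_card0.
  have rE x : x \in D -> r x = [set f x].
    move=> xD; apply/esym/eqP; rewrite eqEcard sub1set fP // cards1.
    exact: small.
  exists f; split=> // x y xD yD fxy; apply/eqP; apply: contraT => nxy.
  have := hallr [set x; y]; rewrite subUset !sub1set xD yD cards2 nxy.
  rewrite bigcup_setU !big_set1 !rE // fxy setUid cards1.
  by move=> /(_ isT).
rewrite negb_forall_in => /exists_inP[x xD]; rewrite -ltnNge.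
move=> /card_gt1P[y1 [y2 [ry1 ry2 ny]]].
pose r' y z := if z == x then r x :\ y else r z.
have r'sub y z : r' y z \subset r z.
  by rewrite /r'; case: eqP => [->|//]; apply: subD1set.
pose hallb y := [forall X : {set A}, (X \subset D) ==>
                   (#|X| <= #|\bigcup_(z in X) r' y z|)].
have step y : y \in r x -> hallb y ->
    exists f : A -> B, {in D &, injective f} /\ {in D, forall z, f z \in r z}.
  move=> ryx /forallP hallr'; have [||f [fi fr]] := IHN (r' y).
  - apply: leq_trans ltN; rewrite (bigD1 x) //= [X in _ < X](bigD1 x) //=.
    rewrite {1}/r' eqxx (cardsD1 y (r x)) ryx add1n addSn ltnS leq_add2l.
    by apply: leq_sum => z _; apply/subset_leq_card/r'sub.
  - by move=> X; apply/implyP.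
  by exists f; split=> // z zD; apply: (subsetP (r'sub y z)); apply: fr.
have violator y : ~~ hallb y -> exists2 X : {set A}, X \subset D &
    #|\bigcup_(z in X) r' y z| < #|X| /\ x \in X.
  rewrite negb_forall => /existsP[X]; rewrite negb_imply -ltnNge.
  case/andP=> XD lt; exists X => //; split=> //; apply: contraLR lt => xX.
  rewrite -leqNgt; apply: leq_trans (hallr X XD) _; apply/subset_leq_card.
  apply/bigcupsP => z zX; apply: (bigcup_max z) => //.
  by rewrite /r'; case: eqP => // zx; rewrite -zx zX in xX.
have [/(step _ ry1)//|/violator[X1 X1D [lt1 xX1]]] := boolP (hallb y1).
have [/(step _ ry2)//|/violator[X2 X2D [lt2 xX2]]] := boolP (hallb y2).
set U1 := \bigcup_(z in X1) r' y1 z in lt1.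
set U2 := \bigcup_(z in X2) r' y2 z in lt2.
have hU : #|X1 :|: X2| <= #|U1 :|: U2|.
  apply: leq_trans (hallr _ _) _; first by rewrite subUset X1D.
  apply/subset_leq_card/bigcupsP => z zX.
  have [->|nzx] := eqVneq z x.
    apply/subsetP => y ryx; rewrite inE; have [yy1|nyy1] := eqVneq y y1.
      apply/orP; right; apply/bigcupP; exists x => //.
      by rewrite /r' eqxx !inE yy1 ny -yy1.
    apply/orP; left; apply/bigcupP; exists x => //.
    by rewrite /r' eqxx !inE nyy1.
  case/setUP: zX => zX.
    apply: subset_trans (subsetUl _ _); apply: (bigcup_max z) => //.
    by rewrite /r' (negbTE nzx).
  apply: subset_trans (subsetUr _ _); apply: (bigcup_max z) => //.
  by rewrite /r' (negbTE nzx).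
have hI : #|(X1 :&: X2) :\ x| <= #|U1 :&: U2|.
  apply: leq_trans (hallr _ _) _.
    by rewrite (subset_trans (subD1set _ _)) // subIset // X1D.
  apply/subset_leq_card/bigcupsP => z; rewrite !inE => /and3P[nzx z1 z2].
  rewrite subsetI; apply/andP; split; apply: (bigcup_max z) => //;
  by rewrite /r' (negbTE nzx).
(* [hU] and [hI] add up to #|X1| + #|X2| - 1 <= #|U1| + #|U2|, but the two violations bound the
   right side by #|X1| + #|X2| - 2. *)
have := cardsUI X1 X2; have := cardsUI U1 U2.
by rewrite (cardsD1 x (X1 :&: X2)) inE xX1 xX2 /=; lia.
Qed.

(** * Estimates for sums and binomial coefficients *)

(** Terms of at most N / 2^(k+1) sum to at most N (1 - 2^-K); the induction proves this with
    denominators cleared. *)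
Lemma sum_geometric_lt (a : nat -> nat) (N K : nat) :
  0 < N -> (forall k, k < K -> 2 ^ k.+1 * a k <= N) -> \sum_(k < K) a k < N.
Proof.
move=> N0 aN.
suff : 2 ^ K * \sum_(k < K) a k + N <= 2 ^ K * N.
  by rewrite -(ltn_pmul2l (m := 2 ^ K)) ?expn_gt0; lia.
elim: K aN => [|K IH] aN; first by rewrite big_ord0 muln0 mul1n.
have {IH} := IH (fun k kK => aN k (ltnW kK)); have := aN K (ltnSn K).
rewrite big_ord_recr /= !expnS mulnDr -!mulnA.
by move: (2 ^ K * a K) (2 ^ K * \sum_(k < K) a k) (2 ^ K * N) => x y z; lia.
Qed.

(* k ^ k / k! <= 'C(2 k, k) <= 4 ^ k *)
Lemma expnn_le_fact k : k ^ k <= 4 ^ k * k`!.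
Proof.
have le_ffact j : j <= k -> k ^ j <= (k + k) ^_ j.
  elim: j => // j IH jk; have jk' := ltnW jk.
  by rewrite expnSr ffactnSr leq_mul ?IH // -addnBA // leq_addr.
apply: leq_trans (le_ffact k (leqnn k)) _.
rewrite -bin_ffact leq_mul2r; apply/orP; right.
rewrite -[4]/(2 ^ 2) -expnM mul2n -addnn.
have -> : 2 ^ (k + k) = \sum_(i < (k + k).+1) 'C(k + k, i).
  by rewrite -[2]/(1 + 1) expnDn; apply: eq_bigr => i _; rewrite !exp1n !muln1.
have lek : k < (k + k).+1 by rewrite ltnS leq_addr.
by rewrite (bigD1 (Ordinal lek)) //= leq_addr.
Qed.

Lemma bin_expn_le n k : 'C(n, k) * k ^ k <= (4 * n) ^ k.
Proof.
apply: leq_trans (leq_mul (leqnn _) (expnn_le_fact k)) _.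
rewrite mulnCA bin_ffact expnMn leq_mul2l; apply/orP; right.
elim: k => // k IH; by rewrite ffactnSr expnSr leq_mul // leq_subr.
Qed.

(** A random [t]-subset of [s] points falls inside [a] given ones with probability at most (a /
    s)^t, factor by factor: (a - i) / (s - i) <= a / s. *)
Lemma bin_ratio_le a s t : a <= s -> 'C(a, t) * s ^ t <= 'C(s, t) * a ^ t.
Proof.
move=> le_as; rewrite -(leq_pmul2r (fact_gt0 t)) mulnAC bin_ffact.
rewrite [leqRHS]mulnAC bin_ffact; elim: t => // t IH.
rewrite !ffactnSr !expnSr mulnACA [leqRHS]mulnACA leq_mul //.
by rewrite !mulnBl [s * a]mulnC leq_sub2l // leq_mul2l le_as orbT.
Qed.

(** * Expanding set families by a union bound *)

Lemma leq_card_bigcup (I T : finType) (A : {set I}) (F : I -> {set T}) c :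
  (forall i, i \in A -> #|F i| <= c) -> #|\bigcup_(i in A) F i| <= #|A| * c.
Proof.
move=> Fc; rewrite -sum_nat_const.
elim/big_ind2: _ => [|X x Y y leX leY|//]; first by rewrite cards0.
exact: leq_trans (leq_card_setU _ _) (leq_add leX leY).
Qed.

(** Choices at different elements are independent, so the count is a product. With [X] empty it
    gives the size of the sample space. *)
Lemma card_restricted_draws (A B : finType) (X : {set A}) (W : {set B}) t :
  #|[set G : {ffun A -> {set B}} |
      [forall u, #|G u| == t] && [forall u in X, G u \subset W]]| =
  'C(#|W|, t) ^ #|X| * 'C(#|B|, t) ^ (#|A| - #|X|).
Proof.
pose F u := [pred V : {set B} | (#|V| == t) && ((u \in X) ==> (V \subset W))].
transitivity #|(family F : simpl_pred {ffun A -> {set B}})|.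
  apply: eq_card => G; rewrite inE.
  apply/andP/familyP => [[/forallP h1 /forallP h2] u|h].
    by rewrite inE h1 h2.
  by split; apply/forallP=> u; have /andP[] := h u.
rewrite card_family foldrE big_map big_enum /=.
rewrite (bigID (mem X)) /=; congr (_ * _).
  rewrite -prod_nat_const; apply: eq_bigr => u uX.
  rewrite -cards_draws -[RHS]cardsE; apply: eq_card => V.
  by rewrite !inE uX /= andbC.
have -> : #|A| - #|X| = #|~: X| by rewrite -(cardsC X) addKn.
rewrite -prod_nat_const; apply: eq_big => [u|u /negbTE uX].
  by rewrite inE.
rewrite -card_draws -[RHS]cardsE; apply: eq_card => V.
by rewrite !inE uX unfold_in andbT.
Qed.

Lemma subset_of_card (T : finType) (A : {set T}) k :
  k <= #|A| -> exists2 B : {set T}, B \subset A & #|B| = k.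
Proof.
rewrite -bin_gt0 -cards_draws card_gt0 => /set0Pn[B].
by rewrite inE => /andP[BA /eqP cB]; exists B.
Qed.

Lemma superset_of_card (T : finType) (A : {set T}) k :
  #|A| <= k -> k <= #|T| -> exists2 B : {set T}, A \subset B & #|B| = k.
Proof.
move=> leAk; rewrite -(cardsC A) -leq_subLR => /subset_of_card[B].
rewrite -disjoints_subset disjoint_sym -setI_eq0 => /eqP AB cB.
by exists (A :|: B); rewrite ?subsetUl // cardsU AB cards0 cB subn0 subnKC.
Qed.

(* Union bound over the sets X of k vertices and the sets W of d k addresses:
   summed over k, the pairs (X, W) with all G u, u in X, inside W account for
   fewer than all choices of t-subsets G u. *)
Lemma expander (m s t d K : nat) :
  t <= s -> d * K <= s ->
  (forall k, 0 < k -> k <= K ->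
     2 ^ k * ('C(m, k) * 'C(s, d * k) * 'C(d * k, t) ^ k) <= 'C(s, t) ^ k) ->
  exists G : {ffun 'I_m -> {set 'I_s}},
    (forall u, #|G u| = t) /\
    (forall X : {set 'I_m}, #|X| <= K -> d * #|X| <= #|\bigcup_(u in X) G u|).
Proof.
move=> le_ts le_dKs small.
pose tfam := [set G : {ffun 'I_m -> {set 'I_s}} | [forall u, #|G u| == t]].
pose bad (X : {set 'I_m}) (W : {set 'I_s}) :=
  [set G : {ffun 'I_m -> {set 'I_s}} |
    [forall u, #|G u| == t] && [forall u in X, G u \subset W]].
pose badk k := \bigcup_(X in [set X : {set 'I_m} | #|X| == k])
                 \bigcup_(W in [set W : {set 'I_s} | #|W| == d * k]) bad X W.
have card_tfam : #|tfam| = 'C(s, t) ^ m.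
  have := card_restricted_draws (set0 : {set 'I_m}) (set0 : {set 'I_s}) t.
  rewrite !cards0 !card_ord subn0 expn0 mul1n => <-; apply: eq_card => G.
  rewrite !inE; case: [forall _, _] => //=; symmetry.
  by apply/forall_inP => u; rewrite inE.
have card_badk k :
    #|badk k| <=
    'C(m, k) * ('C(s, d * k) * ('C(d * k, t) ^ k * 'C(s, t) ^ (m - k))).
  have -> : 'C(m, k) = #|[set X : {set 'I_m} | #|X| == k]|.
    by rewrite card_draws card_ord.
  apply: leq_card_bigcup => X; rewrite inE => /eqP cX.
  have -> : 'C(s, d * k) = #|[set W : {set 'I_s} | #|W| == d * k]|.
    by rewrite card_draws card_ord.
  apply: leq_card_bigcup => W; rewrite inE => /eqP cW.
  by rewrite card_restricted_draws cX cW !card_ord.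
have lt_bad : \sum_(k < K) #|badk k.+1| < #|tfam|.
  apply: (sum_geometric_lt (a := fun k => #|badk k.+1|)) => [|k kK].
    by rewrite card_tfam expn_gt0 bin_gt0 le_ts.
  have [le_km|lt_mk] := leqP k.+1 m; last first.
    move: (card_badk k.+1); rewrite bin_small // mul0n leqn0 => /eqP->.
    by rewrite muln0.
  have -> : #|tfam| = 'C(s, t) ^ k.+1 * 'C(s, t) ^ (m - k.+1).
    by rewrite card_tfam -expnD subnKC.
  apply: leq_trans (leq_mul (leqnn _) (card_badk k.+1)) _.
  rewrite !mulnA leq_mul2r -!mulnA; apply/orP; right.
  by rewrite [X in _ * X]mulnA small.
have [G GT Ggood] : exists2 G, G \in tfam & G \notin \bigcup_(k < K) badk k.+1.
  apply/subsetPn; apply: contraTN lt_bad => /subset_leq_card h.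
  rewrite -leqNgt; apply: leq_trans h _.
  elim/big_ind2: _ => [|A a B b leA leB|//]; first by rewrite cards0.
  exact: leq_trans (leq_card_setU _ _) (leq_add leA leB).
move: (GT); rewrite inE => /forallP cG.
exists G; split=> [u|X XK]; first exact/eqP.
have [->|X0] := eqVneq X set0; first by rewrite cards0 muln0.
apply: contraNT Ggood; rewrite -ltnNge => ltGX.
(* The too small neighbourhood is padded to exactly d #|X| addresses, the size counted in [badk]; d
   K <= s leaves room. *)
have : exists2 W : {set 'I_s}, \bigcup_(u in X) G u \subset W & #|W| = d * #|X|.
  apply: superset_of_card; first exact: ltnW.
  by rewrite card_ord (leq_trans _ le_dKs) // leq_mul2l XK orbT.
case=> W sW cW; move: X0 XK; rewrite -card_gt0.
case cX: #|X| => [//|k] _ kK; apply/bigcupP; exists (Ordinal kK) => //=.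
apply/bigcupP; exists X; first by rewrite inE cX.
apply/bigcupP; exists W; first by rewrite inE cW cX.
rewrite inE; apply/andP; split; first exact/forallP.
by apply/forall_inP => u uX; apply: subset_trans sW; apply: bigcup_sup uX.
Qed.

Lemma leq_expn_r a b k : a <= b -> a ^ k <= b ^ k.
Proof. by case: k => // k le_ab; rewrite leq_exp2r. Qed.

(* Here d = e + 2, so that the exponents d - 1 and d - 2 need no subtraction. *)
Lemma exists_expander (m n s e : nat) :
  0 < n -> n <= m ->
  (256 * e.+2 ^ 2) ^ e.+1 * m * n ^ e <= s ^ e.+1 ->
  exists G : {ffun 'I_m -> {set 'I_s}},
    (forall u, #|G u| = e.+2 + e.+1) /\
    (forall X : {set 'I_m}, #|X| <= 2 * e.+2 * n ->
       e.+2 * #|X| <= #|\bigcup_(u in X) G u|).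
Proof.
move=> n0 le_nm le_s; have m0 : 0 < m := leq_trans n0 le_nm.
have le_s' : 256 * e.+2 ^ 2 * n <= s.
  rewrite -(leq_exp2r _ _ (ltn0Sn e)); apply: leq_trans le_s.
  rewrite expnMn -mulnA leq_mul2l [n ^ _]expnS leq_mul2r le_nm.
  by rewrite !orbT.
have s0 : 0 < s by apply: leq_trans le_s'; rewrite !muln_gt0 n0.
apply: expander; [move: n0 le_s'; rewrite expnS expn1; nia..|].
move=> k k0 kK; set d := e.+2 in le_s le_s' kK *; set t := d + e.+1.
have le_dks : d * k <= s by move: n0 le_s' kK; rewrite expnS expn1; nia.
have hm := bin_expn_le m k; have hs := bin_expn_le s (d * k).
have ht : ('C(d * k, t) * s ^ t) ^ k <= ('C(s, t) * (d * k) ^ t) ^ k.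
  by rewrite leq_exp2r // bin_ratio_le.
(* The k-th root of the union bound: 2 (4 m / k) (4 s / (d k))^d (d k / s)^t <= 1, where t - d = e +
   1. *)
have base : 8 * m * 4 ^ d * (d * k) ^ e.+1 <= k * s ^ e.+1.
  apply: leq_trans (leq_mul (leqnn k) le_s).
  (* This adds d^e to the d^(e+1) already present, hence d^2 in the condition on [s]. *)
  have ke : k ^ e <= (2 * d * n) ^ e by rewrite leq_expn_r.
  have pow : 128 * 8 ^ e <= 256 * 256 ^ e by rewrite leq_mul ?leq_expn_r.
  apply: (@leq_trans (k * m * d ^ e.+1 * (8 * 4 ^ d * (2 * d * n) ^ e))).
    rewrite expnMn [k ^ e.+1]expnS; move: ke.
    move: (k ^ e) (d ^ e.+1) (4 ^ d) ((2 * d * n) ^ e) => x y z w xw.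
    have -> : 8 * m * z * (y * (k * x)) = (k * m * y * 8 * z) * x by lia.
    have -> : k * m * y * (8 * z * w) = (k * m * y * 8 * z) * w by lia.
    by rewrite leq_mul2l xw orbT.
  rewrite !expnMn mulnC.
  rewrite (expnS d e).
  have -> : 4 ^ d = 16 * 4 ^ e by rewrite /d !expnS; lia.
  have e8 : 8 ^ e = 4 ^ e * 2 ^ e by rewrite -expnMn.
  rewrite [256 ^ _]expnS; move: pow; rewrite e8.
  move: (4 ^ e) (2 ^ e) (256 ^ e) (d ^ e) (n ^ e) => x y z v u h.
  have -> : 8 * (16 * x) * (y * v * u) * (k * m * (d * v)) =
          (128 * (x * y)) * (k * m * (d * v) * v * u) by lia.
  have -> : k * (256 * z * (d * v * (d * v)) * m * u) =
          d * (256 * z) * (k * m * (d * v) * v * u) by lia.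
  by rewrite leq_mul // (leq_trans h) // leq_pmull.
have hbase : 2 ^ k * (4 * m) ^ k * (4 * s) ^ (d * k) * ((d * k) ^ t) ^ k
           <= k ^ k * (d * k) ^ (d * k) * (s ^ t) ^ k.
  rewrite !(expnM _ d k) -!expnMn leq_exp2r //.
  rewrite /t !expnD [(4 * s) ^ d]expnMn.
  have := leq_mul (leqnn (s ^ d * (d * k) ^ d)) base.
  move: (4 ^ d) (s ^ d) ((d * k) ^ d) ((d * k) ^ e.+1) (s ^ e.+1) => x y z v w.
  lia.
have pos : 0 < k ^ k * (d * k) ^ (d * k) * (s ^ t) ^ k.
  by rewrite !muln_gt0 !expn_gt0 k0 s0 !muln_gt0 k0.
rewrite -(leq_pmul2r pos).
apply: leq_trans (leq_mul (leqnn ('C(s, t) ^ k)) hbase).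
have := leq_mul (leq_mul (leqnn (2 ^ k)) hm) (leq_mul hs ht).
rewrite ![(_ * _ ^ t) ^ k]expnMn.
move: (2 ^ k) (k ^ k) ('C(m, k)) ('C(s, d * k)) => x1 x2 x3 x4.
move: ((d * k) ^ (d * k)) ('C(d * k, t) ^ k) ((s ^ t) ^ k) => x5 x6 x7.
move: ((4 * m) ^ k) ((4 * s) ^ (d * k)) => x8 x9.
move: ('C(s, t) ^ k) (((d * k) ^ t) ^ k) => x10 x11.
lia.
Qed.

(** * Threshold queries *)

Section QueryTree.
Variables (s d : nat).

(** All of [l] is read even once [c] has reached [d], so that the probed set does not depend on the
    memory. *)
Fixpoint threshold_tree (l : seq 'I_s) (c : nat) : dtree s :=
  if l is i :: l' then Node i (threshold_tree l' c) (threshold_tree l' c.+1)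
  else Leaf (d <= c).

Lemma depth_threshold_tree l c : depth (threshold_tree l c) = size l.
Proof. by elim: l c => //= i l IH c; rewrite !IH maxnn. Qed.

Lemma eval_threshold_tree l c x :
  eval (threshold_tree l c) x = (d <= c + count (tnth x) l).
Proof.
elim: l c => [|i l IH] c /=; first by rewrite addn0.
by case: (tnth x i); rewrite IH ?addSnnS.
Qed.

Lemma probed_threshold_tree l c x :
  probed (threshold_tree l c) x = [set i in l].
Proof.
elim: l c => [|i l IH] c /=; first by apply/setP => j; rewrite !inE.
by apply/setP => j; case: (tnth x i); rewrite !inE IH inE.
Qed.

End QueryTree.

Lemma eval_threshold_tree_enum s d (L : {set 'I_s}) (x : s.-tuple bool) :
  eval (threshold_tree d (enum L) 0) x = (d <= #|[set j in L | tnth x j]|).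
Proof.
rewrite eval_threshold_tree add0n; congr (d <= _).
rewrite -sum1_count big_enum_cond -sum1_card; apply: eq_bigl => j.
by rewrite inE.
Qed.

(** * Memory contents from expansion *)

Section Memory.
Variables (m n s e : nat) (G : 'I_m -> {set 'I_s}) (b0 : 'I_s).
Hypothesis n_gt0 : 0 < n.
Hypothesis cardG : forall u, #|G u| = e.+1 + e.
Hypothesis expandG : forall X : {set 'I_m}, #|X| <= 2 * e.+1 * n ->
  e.+1 * #|X| <= #|\bigcup_(u in X) G u|.

Let nbhd (S : {set 'I_m}) := \bigcup_(u in S) G u.

(* The elements outside S that would be misread if nbhd S were filled with 1s. *)
Let confused (S : {set 'I_m}) :=
  [set u | (u \notin S) && (e < #|G u :&: nbhd S|)].

(** Otherwise [S] and e #|S| + 1 confused elements have at least (e + 1) ((e + 1) #|S| + 1)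
    neighbours. But [S] has at most (2 e + 1) #|S|, and each confused element adds at most e: one
    address too few in total. *)
Lemma card_confused (S : {set 'I_m}) : #|S| <= n -> #|confused S| <= e * #|S|.
Proof.
move=> leSn; rewrite leqNgt; apply/negP => /subset_of_card[T' T'sub cT'].
have dis : S :&: T' = set0.
  apply/eqP; rewrite setI_eq0 disjoint_sym disjoints_subset.
  apply/subsetP => u /(subsetP T'sub); rewrite !inE.
  by case/andP.
have cX : #|S :|: T'| = (e.+1 * #|S|).+1 by rewrite cardsU dis cards0 cT'; lia.
have := expandG (X := S :|: T'); rewrite cX.
have -> : (e.+1 * #|S|).+1 <= 2 * e.+1 * n by nia.
move=> /(_ isT).
have : #|\bigcup_(u in S :|: T') G u| <=
       #|nbhd S :|: \bigcup_(u in T') (G u :\: nbhd S)|.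
  apply/subset_leq_card/subsetP => j /bigcupP[u uST juG].
  rewrite inE; case: (boolP (j \in nbhd S)) => //= jS.
  case/setUP: uST => uX; first by case/bigcupP: jS; exists u.
  by apply/bigcupP; exists u; rewrite // inE jS.
move=> /leq_trans/(_ (leq_card_setU _ _)) h1.
have h2 : #|nbhd S| <= #|S| * (e.+1 + e).
  by apply: leq_card_bigcup => u _; rewrite cardG.
have h3 : #|\bigcup_(u in T') (G u :\: nbhd S)| <= #|T'| * e.
  apply: leq_card_bigcup => u /(subsetP T'sub); rewrite inE => /andP[_].
  by rewrite cardsD cardG; lia.
move: h1 h2 h3; rewrite cT'; nia.
Qed.

(* Hall's theorem gives every element of S and every confused one e.+1 private
   addresses, a majority of its 2 e + 1; write 1 exactly at those owned by S. *)
Lemma majority_memory (S : {set 'I_m}) : #|S| <= n ->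
  exists x : s.-tuple bool,
    forall u, (e < #|[set j in G u | tnth x j]|) = (u \in S).
Proof.
move=> leSn; pose U := S :|: confused S.
have leU : #|U| <= 2 * e.+1 * n.
  apply: leq_trans (leq_card_setU _ _) _.
  have := card_confused leSn; nia.
pose block (u : 'I_m) : {set 'I_m * 'I_e.+1} := setX [set u] [set: 'I_e.+1].
(* Hall's condition for a set of pairs follows from expansion of its projection [Y], with at most
   [e.+1] pairs over each element. *)
have [|f [finj fG]] :=
  hall b0 (D := setX U [set: 'I_e.+1]) (r := fun p => G p.1).
  move=> X XD; pose Y := [set p.1 | p in X].
  have YU : Y \subset U.
    by apply/subsetP => _ /imsetP[[v i] /(subsetP XD)/setXP[? _] ->].
  have : X \subset setX Y [set: 'I_e.+1].
    by apply/subsetP => p pX; rewrite !inE andbT; apply/imsetP; exists p.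
  move=> /subset_leq_card; rewrite cardsX cardsT card_ord mulnC.
  move=> /leq_trans; apply.
  apply: leq_trans (expandG _) _.
    exact: leq_trans (subset_leq_card YU) leU.
  apply/subset_leq_card/bigcupsP => _ /imsetP[p pX ->].
  exact: (bigcup_max p).
have blockD u p : u \in U -> p \in block u -> p \in setX U [set: 'I_e.+1].
  by case: p => v i uU /setXP[/set1P-> _]; rewrite in_setX uU in_setT.
have block_G u : u \in U -> f @: block u \subset G u.
  move=> uU; apply/subsetP => _ /imsetP[p pb ->].
  have := fG _ (blockD _ _ uU pb); by case: p pb => v i /setXP[/set1P-> _].
have card_block u : u \in U -> #|f @: block u| = e.+1.
  move=> uU; rewrite card_in_imset => [|p q pb qb].
    by rewrite cardsX cards1 cardsT card_ord mul1n.
  by apply: finj; apply: blockD uU _.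
pose ones := f @: setX S [set: 'I_e.+1].
exists [tuple j \in ones | j < s] => u.
have -> : [set j in G u | tnth [tuple j \in ones | j < s] j] = G u :&: ones.
  by apply/setP => j; rewrite !inE tnth_mktuple.
case: (boolP (u \in S)) => uS.
  have uU : u \in U by rewrite inE uS.
  rewrite -(card_block u uU); apply/subset_leq_card.
  rewrite subsetI block_G //; apply: imsetS.
  by rewrite setXS // sub1set.
apply/negbTE; rewrite -leqNgt.
have ones_nbhd : ones \subset nbhd S.
  apply/subsetP => _ /imsetP[[v i] /setXP[vS _] ->].
  apply/bigcupP; exists v => //; apply: (fG (v, i)).
  by rewrite !inE vS.
(* An unconfused [u] meets [nbhd S] in at most e addresses; a confused one owns e + 1 addresses
   holding 0, which leaves at most e of its 2 e + 1. *)
case: (boolP (u \in confused S)) => [uT|]; last first.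
  rewrite inE uS /= -leqNgt; apply: leq_trans.
  by rewrite subset_leq_card // setIS.
have uU : u \in U by rewrite inE uT orbT.
have : f @: block u \subset G u :\: ones.
  rewrite subsetD block_G //= disjoints_subset.
  apply/subsetP => _ /imsetP[p pb ->].
  rewrite inE; apply/imsetP => -[[v i] /setXP[vS _]] /finj epq.
  have {epq} pE : p = (v, i).
    by apply: epq; [exact: blockD uU pb | rewrite !inE vS].
  by move: pb uS; rewrite pE => /setXP[/set1P<- _]; rewrite vS.
move=> /subset_leq_card; rewrite card_block //.
have := cardsID ones (G u); rewrite cardG.
by move: #|G u :&: ones| #|G u :\: ones| => x y; lia.
Qed.

End Memory.

(** * Assembly of the scheme *)

Lemma exists_nonadaptive_scheme (m n s t e : nat) :
  0 < n -> n <= m -> e.+2 + e.+1 <= t ->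
  (256 * e.+2 ^ 2) ^ e.+1 * m * n ^ e <= s ^ e.+1 ->
  exists P : scheme m n s t, nonadaptive P.
Proof.
move=> n0 le_nm le_t le_s.
have [G [cG exG]] := exists_expander n0 le_nm le_s.
(* Hall's theorem needs a default address; [s] = 0 is impossible because [G u] is nonempty. *)
case: s => [|s] in le_s G cG exG *.
  have m0 := leq_trans n0 le_nm.
  by have := max_card (G (Ordinal m0)); rewrite cG card_ord.
have memP (S : {S : {set 'I_m} | #|S| <= n}) :
    exists x : s.+1.-tuple bool,
      forall u, (e.+1 < #|[set j in G u | tnth x j]|) = (u \in sval S).
  exact: (majority_memory ord0 n0 cG exG (valP S)).
have [st stP] := fin_all_exists memP.
pose tree u := threshold_tree e.+2 (enum (G u)) 0.
have depth_tree u : depth (tree u) <= t.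
  by rewrite depth_threshold_tree -cardE cG.
pose qu : query_scheme m s.+1 t := fun u => exist _ (tree u) (depth_tree u).
have quP S u : eval (sval (qu u)) (st S) = true <-> u \in sval S.
  by rewrite /= eval_threshold_tree_enum stP.
exists (Scheme quP) => u; exists (G u); split; first by rewrite cG.
move=> x; rewrite /= probed_threshold_tree; apply/setP => j.
by rewrite inE mem_enum.
Qed.

(** * The real bound on the memory size *)

Local Open Scope ring_scope.

Lemma le_lg (R : realType) (k : nat) (x : R) : 2 ^+ k <= x -> k%:R <= lg x.
Proof.
move=> le_x; have ln2_gt0 : 0 < ln 2 :> R by apply: ln_gt0; lra.
rewrite /lg ler_pdivlMr // mulrC mulr_natr -lnXn ?ler_ln ?posrE ?exprn_gt0 //.
by apply: lt_le_trans le_x; rewrite exprn_gt0.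
Qed.

Section GeometricMean.
Variables (R : realType) (m n e : nat).
Hypotheses (n_gt0 : (0 < n)%N) (le_nm : (n <= m)%N).
Let a : R := e.+1%:R^-1.
(** The main factor of the claimed bound: [a] is 2 / (t - 1) for t = 2 e + 3. Its power turns the
    condition on [s] into 256 (e + 2)^2 [mean] <= s. *)
Let mean : R := m%:R `^ a * n%:R `^ (1 - a).

Lemma geometric_meanX : mean ^+ e.+1 = m%:R * n%:R ^+ e.
Proof.
have e0 : e.+1%:R != 0 :> R by rewrite pnatr_eq0.
rewrite /mean exprMn -!powR_mulrn ?powR_ge0 // -!powRrM mulVf // powRr1 //.
by congr (_ * _ `^ _); rewrite mulrBl mulVf // mul1r -natr1 addrK.
Qed.

Lemma le_geometric_mean : n%:R <= mean.
Proof.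
have nR : 0 < n%:R :> R by rewrite ltr0n.
have {1}-> : n%:R = n%:R `^ a * n%:R `^ (1 - a) :> R.
  by rewrite -powRD ?(gt_eqF nR) ?implybT // addrC subrK powRr1 // ltW.
rewrite ler_wpM2r ?powR_ge0 // ge0_ler_powR ?nnegrE ?ler0n ?ler_nat //.
by rewrite /a invr_ge0 ler0n.
Qed.

End GeometricMean.

Theorem theorem4 (R : realType) :
  exists C : R, 0 < C /\ exists m0 : nat,
    forall t n m : nat,
      odd t -> (5 <= t)%N -> (0 < n)%N -> (n <= m)%N -> (m0 <= m)%N ->
      exists s : nat,
        (exists P : scheme m n s t, nonadaptive P) /\
        s%:R <= C * t%:R * m%:R `^ (2 / (t%:R - 1))
                  * n%:R `^ (1 - 2 / (t%:R - 1)) * lg (2 * m%:R / n%:R).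
Proof.
(* 1536 = 512 * 3: 512 is 256 doubled, for rounding in one case and for m <= 2^k n in the other; 3
   comes from k + 2 <= 3 L. *)
exists 1536; split=> //; exists 0%N => t n m odd_t t5 n0 le_nm _.
have [e tE] : exists e, t = (e.+2 + e.+1)%N by exists t./2.-1; lia.
have nR : 0 < n%:R :> R by rewrite ltr0n.
have -> : 2 / (t%:R - 1) = e.+1%:R^-1 :> R.
  have -> : t%:R - 1 = 2 * e.+1%:R :> R by rewrite tE natrD -(natr1 e.+1); ring.
  by rewrite invfM mulrA divff ?mul1r // pnatr_eq0.
have := le_geometric_mean R e n0 le_nm; have := geometric_meanX R m n e.
set B := m%:R `^ _ * _ => BX leB; rewrite -[_ * t%:R * _ * _]mulrA -/B.
set L := lg _.
have B0 : 0 <= B by apply: le_trans leB; apply: ltW.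
have t0 : 0 <= t%:R :> R by rewrite ler0n.
(* [k] is lg(m / n) rounded up; for k > 0, minimality gives 2^(k-1) n < m, hence k <= L. *)
have [k le_m k_min] : exists2 k, (m <= 2 ^ k * n)%N & k%:R <= L /\ 1 <= L.
  have ex : exists k, (m <= 2 ^ k * n)%N.
    by exists m; rewrite (leq_trans (ltnW (ltn_expl m (ltnSn 1)))) // leq_pmulr.
  have L1 : 1 <= L.
    apply: (@le_lg R 1); rewrite expr1 ler_pdivlMr // ler_pM2l //.
    by rewrite ler_nat.
  case: (ex_minnP ex) => k le_k k_min; exists k => //; split=> //.
  case: k k_min le_k => [|k] k_min _; first exact: le_trans L1.
  apply: le_lg; rewrite ler_pdivlMr // exprS -mulrA ler_pM2l //.
  rewrite -natrX -natrM ler_nat leqNgt; apply/negP => lt.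
  by have := k_min k (ltnW lt); rewrite ltnn.
case: k_min => leL L1.
have k3L : k.+2%:R <= 3 * L by rewrite -addn2 natrD; lra.
have [le_ek|lt_ke] := leqP e k.
(* One factor d = e + 2 is charged to 3 L, the other to t. Rounding [c] up costs 1, absorbed by 1 <=
   d^2 B. *)
- pose c : R := 256 * e.+2%:R ^+ 2 * B.
  have c0 : 0 <= c by rewrite mulr_ge0 // -natrX -natrM ler0n.
  exists (Num.truncn c).+1; split.
    apply: (@exists_nonadaptive_scheme _ _ _ _ e); rewrite ?tE //.
    rewrite -(ler_nat R) !natrM !natrX natrM natrX -mulrA -BX -exprMn.
    apply: lerXn2r; rewrite ?nnegrE ?ler0n //.
    exact/ltW/truncnS_gt.
  have le_d : e.+2%:R <= 3 * L by apply: le_trans k3L; rewrite ler_nat !ltnS.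
  have le_dt : e.+2%:R <= t%:R :> R by rewrite ler_nat tE leq_addr.
  have d1 : 1 <= e.+2%:R :> R by rewrite (ler_nat R 1).
  have le_d2 : e.+2%:R ^+ 2 <= 3 * L * t%:R by rewrite expr2 ler_pM.
  have d2B1 : 1 <= e.+2%:R ^+ 2 * B.
    by rewrite mulr_ege1 ?exprn_ege1 // (le_trans _ leB) // (ler_nat R 1).
  have le_s : (Num.truncn c).+1%:R <= c + 1 by rewrite -natr1 lerD2r truncn_le.
  apply: le_trans le_s _; move: d2B1 (ler_wpM2r B0 le_d2).
  rewrite /c -[256 * _ * B]mulrA; set p := _ * B => p1 le_p.
  have -> : 1536 * t%:R * B * L = 512 * (3 * L * t%:R * B) by ring.
  lra.
(* Now d = k + 2, with 2 k + 3 probes. As m <= 2^k n, doubling 256 satisfies the condition on [s];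
   one d is charged to 3 L, the other to t, and n <= B. *)
exists (512 * k.+2 ^ 2 * n)%N; split.
  apply: (@exists_nonadaptive_scheme _ _ _ _ k) => //; first by lia.
  have -> : (512 * k.+2 ^ 2 * n = 256 * k.+2 ^ 2 * (2 * n))%N by lia.
  rewrite [X in (_ <= X)%N]expnMn -mulnA leq_mul2l; apply/orP; right.
  rewrite expnMn [(n ^ k.+1)%N]expnS mulnA leq_mul2r; apply/orP; right.
  by rewrite (leq_trans le_m) // leq_mul2r leq_exp2l ?leqnSn ?orbT.
have le_kt : k.+2%:R <= t%:R :> R by rewrite ler_nat tE; lia.
have -> : 1536 * t%:R * B * L = 512 * (3 * L * t%:R) * B by ring.
rewrite natrM [(512 * _)%:R]natrM natrX ler_pM ?mulr_ge0 ?exprn_ge0 //.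
by rewrite ler_pM2l // expr2 ler_pM.
Qed.
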